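(* Let $L$ be the link graph of the random triangular presentation $\Gamma(n,p)$. There exists a constant $C>0$ such that if $p=p(n)\ge C\log n/n^2$, then asymptotically almost surely $\lambda_2[\mathcal L(L)]>1/2$.
   Context: The random triangular group $\Gamma(n,p)$ is given by a presentation $\langle S\mid R\rangle$, where $|S|=n$ and $R$ contains independently, each with probability $p$, every cyclically reduced word $abc$ of length three over $S\cup S^{-1}$ ($a\neq b^{-1}$, $b\neq c^{-1}$, $c\neq a^{-1}$; distinct words are distinct candidates). The link graph $L$ of a triangular presentation $\langle S\mid R\rangle$ is the multigraph with vertex set $S\cup S^{-1}$ (generators and their formal inverses, $2n$ vertices) in which every relation $abc\in R$ contributes the three edges $\{a,b^{-1}\}$, $\{b,c^{-1}\}$, $\{c,a^{-1}\}$ (multiple edges allowed). For a multigraph $G$ with adjacency matrix $A=(a_{vw})$ ($a_{vw}$ = number of edges between $v$ and $w$) and degrees $d_G(v)$, the normalized Laplacian $\mathcal L(G)=(b_{vw})$ has $b_{vv}=1$ if $d_G(v)>0$, $b_{vw}=-a_{vw}/\sqrt{d_G(v)d_G(w)}$ if $v,w$ are adjacent, and $0$ otherwise; its eigenvalues are $0=\lambda_1\le\lambda_2\le\dots$, and $\lambda_2[\mathcal L(G)]$ denotes the second smallest. Asymptotically almost surely means with probability tending to $1$ as $n\to\infty$. *)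

(* Defs.v *)
From HB Require Import structures.
From mathcomp Require Import all_boot all_order all_algebra.
From mathcomp Require Import reals exp.
From Stdlib Require Import ClassicalEpsilon.
Set Implicit Arguments. Unset Strict Implicit. Unset Printing Implicit Defensive.
Import Order.TTheory GRing.Theory Num.Theory.
Local Open Scope ring_scope.

(* A letter of S ∪ S^{-1}, |S| = n: (i, false) is the generator s_i,
   (i, true) its formal inverse s_i^{-1}. *)
Definition letter (n : nat) := ('I_n * bool)%type.
Definition linv n (a : letter n) : letter n := (a.1, ~~ a.2).

Definition word (n : nat) := (letter n * letter n * letter n)%type.

Definition cyc_reduced n (w : word n) : bool :=
  let: (a, b, c) := w in
  [&& a != linv b, b != linv c & c != linv a].

Definition candidates n : {set word n} := [set w | cyc_reduced w].

Definition edge_mult n (x y v w : letter n) : nat :=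
  ((v == x) && (w == y)) + ((v == y) && (w == x)).

Definition link_adj n (Rel : {set word n}) (v w : letter n) : nat :=
  \sum_(r in Rel)
    let: (a, b, c) := r in
    edge_mult a (linv b) v w + edge_mult b (linv c) v w + edge_mult c (linv a) v w.

Definition link_deg n (Rel : {set word n}) (v : letter n) : nat :=
  \sum_(w : letter n) link_adj Rel v w.

Definition norm_laplacian (R : realType) n (Rel : {set word n})
  : 'M[R]_(#|{: letter n}|) :=
  \matrix_(i, j)
    let v := enum_val i in let w := enum_val j in
    if i == j then (if (0 < link_deg Rel v)%N then 1 else 0)
    else if (0 < link_adj Rel v w)%N then
      - (link_adj Rel v w)%:R / Num.sqrt ((link_deg Rel v)%:R * (link_deg Rel w)%:R)
    else 0.

Definition is_sorted_spectrum (R : realType) m (A : 'M[R]_m) (s : seq R) : Prop :=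
  sorted <=%R s /\ char_poly A = \prod_(x <- s) ('X - x%:P).

Definition sorted_eigenvalues (R : realType) m (A : 'M[R]_m) : seq R :=
  epsilon (inhabits [::]) (is_sorted_spectrum A).

Definition lambda2 (R : realType) m (A : 'M[R]_m) : R :=
  nth 0 (sorted_eigenvalues A) 1.

(* Probability, in Gamma(n,p), of the event E on the relator set:
   every candidate is included independently with probability p. *)
Definition gamma_prob (R : realType) n (p : R) (E : {set word n} -> bool) : R :=
  \sum_(Rel : {set word n} | (Rel \subset candidates n) && E Rel)
     p ^+ #|Rel| * (1 - p) ^+ (#|candidates n| - #|Rel|).

(* Main.v *)
Require Import Defs.
From HB Require Import structures.
From mathcomp Require Import all_boot all_order all_algebra.
From mathcomp Require Import complex reals sequences exp.
From mathcomp Require Import ring lra zify.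
From Stdlib Require Import ClassicalEpsilon.
Set Implicit Arguments. Unset Strict Implicit. Unset Printing Implicit Defensive.
Import Order.TTheory GRing.Theory Num.Theory.
Local Open Scope ring_scope.

(** Let A and D be the adjacency and degree matrices of the link graph. By
    Courant-Fischer, lambda_2 > 1/2 as soon as the quadratic form of D/2 - A is
    positive on the nonzero vectors whose coordinates sum to 0. Writing D/2 - A
    as the sum of the contributions Q_r of the chosen relators r, its mean is
    computed exactly: on sum-zero vectors it is at least (p t / 2) |y|^2, where
    t ~ 24 n^2 is the degree of a vertex when all candidates are chosen. So it
    suffices that the centred matrix M = sum_r (1_r - p) Q_r has no eigenvalue
    <= - p t / 2, and this follows from Markov's inequality for tr M^(2k) with k
    of order log n. Expanding the trace along walks, a product of centred
    variables has zero mean unless every relator occurs at least twice, so at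
    most k distinct relators matter; each step of the walk uses a new relator
    (total weight O(p t)) or one of at most 2k old ones, whence
    E tr M^(2k) <= 2n (O(k p t))^k. Since p t >= C' log n with C' large, this is
    much smaller than (p t / 2)^(2k). *)

(** * Moments of centred Bernoulli sums of matrices *)

Lemma prod_seq_count (R : comPzRingType) (I : finType) (F : I -> R) (s : seq I) :
  \prod_(i <- s) F i = \prod_i F i ^+ count_mem i s.
Proof.
elim: s => [|a s IHs]; first by rewrite big_nil big1.
rewrite big_cons IHs; under [RHS]eq_bigr do rewrite /= exprD.
rewrite big_split /=; congr (_ * _).
rewrite (bigD1 a) //= eqxx expr1 big1 ?mulr1 // => i /negPf.
by rewrite eq_sym => ->.
Qed.

Lemma size_sum_count (I : finType) (s : seq I) :
  size s = (\sum_i count_mem i s)%N.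
Proof.
elim: s => [|a s IHs] /=; first by rewrite big1.
rewrite big_split /= -IHs (bigD1 a) //= eqxx big1 ?addn0 // => i /negPf.
by rewrite eq_sym => ->.
Qed.

Section BernoulliProduct.
Variables (R : realFieldType) (I : finType) (q : I -> R).
Hypothesis q01 : forall i, 0 <= q i <= 1.

Definition bern_weight (J : {set I}) : R :=
  \prod_i (if i \in J then q i else 1 - q i).
Definition bern_expect (f : {set I} -> R) : R :=
  \sum_(J : {set I}) bern_weight J * f J.
Definition centred (J : {set I}) (i : I) : R := (i \in J)%:R - q i.

Lemma bern_weight_ge0 J : 0 <= bern_weight J.
Proof.
apply: prodr_ge0 => i _; have /andP[q0 q1] := q01 i.
by case: ifP; rewrite ?subr_ge0.
Qed.

(** Independence: expanding the product of two-term sums over all choices of a term at each index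
    yields the sum over all sets [J]. *)
Lemma bern_expect_prod (F : I -> bool -> R) :
  bern_expect (fun J => \prod_i F i (i \in J)) =
  \prod_i (q i * F i true + (1 - q i) * F i false).
Proof.
rewrite bigA_distr; apply: eq_bigr => J _; rewrite -big_split /=.
by apply: eq_bigr => i _; case: (i \in J).
Qed.

Lemma bern_weight_sum : \sum_(J : {set I}) bern_weight J = 1.
Proof.
transitivity (\prod_i (q i + (1 - q i))); first by rewrite bigA_distr.
by rewrite big1 // => i _; rewrite addrC subrK.
Qed.

Lemma eq_bern_expect f g : f =1 g -> bern_expect f = bern_expect g.
Proof. by move=> fg; apply: eq_bigr => J _; rewrite fg. Qed.

Lemma bern_expect_sum (T : finType) (f : T -> {set I} -> R) :
  bern_expect (fun J => \sum_x f x J) = \sum_x bern_expect (f x).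
Proof.
rewrite /bern_expect exchange_big /=.
by apply: eq_bigr => J _; rewrite mulr_sumr.
Qed.

Lemma bern_expectZ a f : bern_expect (fun J => a * f J) = a * bern_expect f.
Proof. by rewrite /bern_expect mulr_sumr; apply: eq_bigr => J _; rewrite mulrCA. Qed.

(** Both deviations 1 - q and q lie in [0,1], so a moment of order at least 2 is dominated by the
    variance q(1 - q), hence by q. *)
Lemma centred_moment_le (i : I) (a : nat) : a != 1%N ->
  `|q i * (1 - q i) ^+ a + (1 - q i) * (0 - q i) ^+ a| <= (if (0 < a)%N then q i else 1).
Proof.
have /andP[q0 q1] := q01 i; have q1' : 0 <= 1 - q i by rewrite subr_ge0.
have [->|a0 a1] := posnP a; first by rewrite !expr0 !mulr1 addrC subrK normr1.
have a2 : (2 <= a)%N by case: a a0 a1 => [|[|]].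
rewrite sub0r (le_trans (ler_normD _ _)) // !normrM !normrX normrN.
rewrite !(ger0_norm q0) !(ger0_norm q1').
have h1 : (1 - q i) ^+ a <= (1 - q i) ^+ 2 by rewrite ler_wiXn2l // lerBlDr lerDl.
have h2 : q i ^+ a <= q i ^+ 2 by rewrite ler_wiXn2l.
apply: (le_trans (lerD (ler_wpM2l q0 h1) (ler_wpM2l q1' h2))).
have -> : q i * (1 - q i) ^+ 2 + (1 - q i) * q i ^+ 2 = q i * (1 - q i) by ring.
by rewrite ler_piMr // lerBlDr lerDl.
Qed.

(** An index occurring exactly once makes the expectation vanish. Otherwise [s] has at most k
    distinct indices, so [lam ^+ k] outweighs one division by [lam] for each; the product over
    [i in s] counts a repeated index once. *)
Lemma centred_prod_moment_le (lam : R) (k : nat) (s : seq I) :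
  1 <= lam -> (size s <= k.*2)%N ->
  `|bern_expect (fun J => \prod_(i <- s) centred J i)|
    <= lam ^+ k * \prod_(i in s) (q i / lam).
Proof.
move=> lam1 sk; have lam0 : 0 < lam by apply: lt_le_trans lam1.
have -> : bern_expect (fun J => \prod_(i <- s) centred J i) =
    \prod_i (q i * (1 - q i) ^+ count_mem i s + (1 - q i) * (0 - q i) ^+ count_mem i s).
  rewrite -(bern_expect_prod (fun i b => (b%:R - q i) ^+ count_mem i s)).
  by apply: eq_bern_expect => J; rewrite prod_seq_count.
have g0 : 0 <= lam ^+ k * \prod_(i in s) (q i / lam).
  rewrite mulr_ge0 ?exprn_ge0 ?(ltW lam0) // prodr_ge0 // => i _.
  by rewrite divr_ge0 ?(ltW lam0) //; case/andP: (q01 i).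
have [/existsP[i /eqP ci]|/existsPn ns] := boolP [exists i, count_mem i s == 1%N].
  rewrite (bigD1 i) //= ci !expr1.
  have -> : q i * (1 - q i) + (1 - q i) * (0 - q i) = 0 by ring.
  by rewrite mul0r normr0.
rewrite normr_prod.
have card_s : (#|s| <= k)%N.
  rewrite -leq_double (leq_trans _ sk) // size_sum_count.
  rewrite -muln2 -sum_nat_const [leqRHS](bigID (mem s)) /=.
  rewrite (leq_trans _ (leq_addr _ _)) // leq_sum // => i si.
  have c0 : (0 < count_mem i s)%N by rewrite -has_count has_pred1.
  by move: (ns i) c0; case: (count_mem i s) => [|[|]].
apply: le_trans (_ : \prod_(i in s) q i <= _).
  rewrite [leRHS]big_mkcond /=; apply: ler_prod => i _; rewrite normr_ge0 /=.
  by rewrite (le_trans (centred_moment_le _ (ns i))) // -has_count has_pred1.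
rewrite big_split /= prodr_const mulrCA ler_peMr //.
  by apply: prodr_ge0 => i _; case/andP: (q01 i).
by rewrite exprVn -exprB // ?unitfE ?gt_eqF // exprn_ege1.
Qed.

(** One step of the walk: the first factor of [M J ^+ L.+1] is expanded and its index is pushed onto
    [s]. *)
Lemma bern_expect_mul_step n (Q : I -> 'M[R]_n) (s : seq I) (L : nat) (v u : 'I_n) :
  let M J := \sum_i centred J i *: Q i in
  bern_expect (fun J => (\prod_(i <- s) centred J i) * (M J ^+ L.+1) v u) =
  \sum_i \sum_x Q i v x *
    bern_expect (fun J => (\prod_(i <- i :: s) centred J i) * (M J ^+ L) x u).
Proof.
move=> M; under [RHS]eq_bigr do
  (under eq_bigr do rewrite -bern_expectZ; rewrite -bern_expect_sum).
rewrite -bern_expect_sum; apply: eq_bern_expect => J.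
rewrite exprS mxE exchange_big /= mulr_sumr; apply: eq_bigr => x _.
rewrite summxE mulr_suml mulr_sumr; apply: eq_bigr => i _.
by rewrite big_cons !mxE; ring.
Qed.

(** * Trace moments by expansion along walks *)

Section TraceMoment.
Variables (n k : nat) (Q : I -> 'M[R]_n) (K D lam : R).
Hypotheses (lam1 : 1 <= lam) (K0 : 0 <= K).
Hypothesis rowQ : forall i v, \sum_u `|Q i v u| <= K.
Hypothesis rowqQ : forall v, \sum_i q i * \sum_u `|Q i v u| <= D.

Let M J := \sum_i centred J i *: Q i.
Let B := D / lam + k.*2%:R * K.

(* [s] lists the indices already used by the walk. A step through a new index
   costs q/lam, and there are at most 2k used ones; the factor lam^k pays for the
   division by lam because at most k distinct indices contribute. *)
Lemma power_entry_moment_le (L : nat) (s : seq I) (v u : 'I_n) :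
  (size s + L <= k.*2)%N ->
  `|bern_expect (fun J => (\prod_(i <- s) centred J i) * (M J ^+ L) v u)|
    <= lam ^+ k * (\prod_(i in s) (q i / lam)) * B ^+ L.
Proof.
have lam0 : 0 < lam by apply: lt_le_trans lam1.
have q0 i : 0 <= q i by case/andP: (q01 i).
have g0 t : 0 <= \prod_(i in (t : seq I)) (q i / lam).
  by rewrite prodr_ge0 // => i _; rewrite divr_ge0 ?(ltW lam0).
elim: L s v u => [|L IHL] s v u sk.
  rewrite addn0 in sk; rewrite expr0 mulr1.
  rewrite (@eq_bern_expect _ (fun J => (v == u)%:R * \prod_(i <- s) centred J i)).
    rewrite bern_expectZ normrM (le_trans _ (centred_prod_moment_le lam1 sk)) //.
    by rewrite ler_piMl // normr_nat lern1 leq_b1.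
  by move=> J; rewrite expr0 mxE mulrC.
rewrite bern_expect_mul_step (le_trans (ler_norm_sum _ _ _)) //.
have B0 : 0 <= D.
  rewrite (le_trans _ (rowqQ v)) // sumr_ge0 // => i _.
  by rewrite mulr_ge0 // sumr_ge0.
have {}B0 : 0 <= B by rewrite /B addr_ge0 ?mulr_ge0 // invr_ge0 ltW.
set G := lam ^+ k * _; have G0 : 0 <= G by rewrite mulr_ge0 ?exprn_ge0 ?(ltW lam0).
have step i : `|\sum_x Q i v x * bern_expect (fun J =>
    (\prod_(j <- i :: s) centred J j) * (M J ^+ L) x u)| <=
    (G * B ^+ L) * ((if i \in s then 1 else q i / lam) * \sum_x `|Q i v x|).
  rewrite (le_trans (ler_norm_sum _ _ _)) // mulrA mulr_sumr ler_sum // => x _.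
  rewrite normrM mulrC ler_wpM2r // (le_trans (IHL _ _ _ _)) ?addSnnS //.
  rewrite -!mulrA ler_wpM2l ?exprn_ge0 ?(ltW lam0) // [leRHS]mulrCA [leLHS]mulrC.
  rewrite ler_wpM2l ?exprn_ge0 //.
  (* An old index leaves the set of used indices unchanged; a new one adds its factor
     [q i / lam]. *)
  case: ifP => si.
    rewrite mulr1 le_eqVlt; apply/orP; left; apply/eqP; apply: eq_bigl => j.
    by rewrite !inE; case: eqP => // ->.
  rewrite (bigD1 i) ?inE ?eqxx //= mulrC le_eqVlt; apply/orP; left; apply/eqP.
  congr (_ * _); apply: eq_bigl => j; rewrite !inE.
  by case: eqVneq => [->|] //=; rewrite ?si ?andbF ?andbT.
rewrite (le_trans (ler_sum _ (fun i _ => step i))) // -mulr_sumr exprS.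
rewrite [leRHS]mulrCA [leRHS]mulrC ler_wpM2l ?mulr_ge0 ?exprn_ge0 ?(ltW lam0) //.
(* New indices contribute at most D / lam in total and old ones at most 2k K, which add up to
   [B]. *)
rewrite (bigID (mem s)) /= addrC lerD //.
  rewrite ler_pdivlMr // mulr_suml (le_trans _ (rowqQ v)) //.
  rewrite [leRHS](bigID (mem s)) /= ler_wpDl ?sumr_ge0 // => [i _|].
    by rewrite mulr_ge0 // sumr_ge0.
  apply: ler_sum => i /negPf ->.
  by rewrite mulrAC divfK ?gt_eqF.
apply: le_trans (_ : \sum_(i in s) K <= _).
  by apply: ler_sum => i ->; rewrite mul1r.
rewrite sumr_const -[leLHS]mulr_natl ler_wpM2r // ler_nat.
by rewrite (leq_trans (card_size s)) // (leq_trans _ sk) // leq_addr.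
Qed.

Lemma trace_moment_le :
  bern_expect (fun J => \tr (M J ^+ k.*2)) <= n%:R * (lam ^+ k * B ^+ k.*2).
Proof.
rewrite bern_expect_sum (le_trans (ler_norm _)) //.
rewrite (le_trans (ler_norm_sum _ _ _)) //.
apply: le_trans (_ : \sum_(i < n) lam ^+ k * B ^+ k.*2 <= _).
  apply: ler_sum => v _; have := @power_entry_moment_le k.*2 [::] v v (leqnn _).
  rewrite big_pred0 // mulr1; congr (`|_| <= _).
  by apply: eq_bern_expect => J; rewrite big_nil mul1r.
by rewrite sumr_const card_ord mulr_natl.
Qed.
End TraceMoment.
End BernoulliProduct.

(** * Traces of even powers and quadratic forms *)

Lemma cauchy_schwarz_sum (R : realFieldType) (I : finType) (f g : I -> R) :
  (\sum_i f i * g i) ^+ 2 <= (\sum_i f i ^+ 2) * (\sum_i g i ^+ 2).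
Proof.
set a := \sum_i f i ^+ 2; set b := \sum_i _; set c := \sum_i g i ^+ 2.
have a0 : 0 <= a by apply: sumr_ge0 => i _; exact: sqr_ge0.
have : 0 <= \sum_i (b * f i - a * g i) ^+ 2 by apply: sumr_ge0 => i _; exact: sqr_ge0.
have -> : \sum_i (b * f i - a * g i) ^+ 2 = a * (a * c - b ^+ 2).
  rewrite (eq_bigr (fun i => b ^+ 2 * f i ^+ 2 - (2 * a * b) * (f i * g i)
    + a ^+ 2 * g i ^+ 2)) => [|i _]; last by ring.
  by rewrite big_split /= sumrB -!mulr_sumr -/a -/b -/c; ring.
have [a_eq0 _|a_neq0] := eqVneq a 0; last first.
  by rewrite pmulr_rge0 ?subr_ge0 // lt_def a_neq0.
suff -> : b = 0 by rewrite a_eq0 expr0n mul0r.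
rewrite /b big1 // => i _; suff -> : f i = 0 by rewrite mul0r.
have /eqP := a_eq0; rewrite psumr_eq0 => [/allP/(_ i)|j _]; last exact: sqr_ge0.
by rewrite mem_index_enum sqrf_eq0 => /(_ isT)/eqP.
Qed.

Definition qform (R : realFieldType) n (A : 'M[R]_n) (y : 'I_n -> R) : R :=
  \sum_i \sum_j y i * A i j * y j.

Section SymmetricPowers.
Variables (R : realFieldType) (n : nat) (M : 'M[R]_n).
Hypothesis Msym : forall i j, M i j = M j i.

Lemma sym_power m i j : (M ^+ m) i j = (M ^+ m) j i.
Proof.
elim: m i j => [|m IHm] i j; first by rewrite !expr0 !mxE eq_sym.
rewrite {1}exprS exprSr !mxE; apply: eq_bigr => k _.
by rewrite Msym IHm mulrC.
Qed.

(** By symmetry the trace is the squared Frobenius norm of [M ^+ m]. *)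
Lemma trace_even_power m : \tr (M ^+ (m + m)) = \sum_j \sum_i (M ^+ m) i j ^+ 2.
Proof.
apply: eq_bigr => j _; rewrite exprD mxE.
by apply: eq_bigr => i _; rewrite sym_power expr2.
Qed.

Lemma trace_even_power_ge0 m : 0 <= \tr (M ^+ (m + m)).
Proof.
rewrite trace_even_power; apply: sumr_ge0 => j _; apply: sumr_ge0 => i _.
exact: sqr_ge0.
Qed.

Let vecpow (y : 'I_n -> R) m j := \sum_i y i * (M ^+ m) i j.

Lemma qform_even_power y m :
  qform (M ^+ (m + m)) y = \sum_j vecpow y m j ^+ 2.
Proof.
rewrite /qform; transitivity (\sum_i \sum_k \sum_j y i * ((M ^+ m) i j * (M ^+ m) k j) * y k).
  apply: eq_bigr => i _; apply: eq_bigr => k _.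
  rewrite exprD mxE mulr_sumr mulr_suml; apply: eq_bigr => j _.
  by rewrite [in (M ^+ m) k j]sym_power.
rewrite exchange_big /= exchange_big /=.
under eq_bigr do rewrite exchange_big /=.
rewrite exchange_big /=; apply: eq_bigr => j _.
rewrite expr2 /vecpow mulr_suml; apply: eq_bigr => i _.
by rewrite mulr_sumr; apply: eq_bigr => k _; ring.
Qed.

(** Cauchy-Schwarz for [y] and the row vector y M^m. *)
Lemma qform_power_sqr y m :
  qform (M ^+ m) y ^+ 2 <= (\sum_i y i ^+ 2) * qform (M ^+ (m + m)) y.
Proof.
rewrite qform_even_power.
have -> : qform (M ^+ m) y = \sum_i y i * vecpow y m i.
  rewrite /qform exchange_big /=; apply: eq_bigr => i _.
  by rewrite mulrC mulr_suml.
exact: cauchy_schwarz_sum.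
Qed.

Lemma qform_even_power_le_trace y m :
  qform (M ^+ (m + m)) y <= (\sum_i y i ^+ 2) * \tr (M ^+ (m + m)).
Proof.
rewrite qform_even_power trace_even_power mulr_sumr.
by apply: ler_sum => j _; exact: cauchy_schwarz_sum.
Qed.

(** Each use of [qform_power_sqr] doubles the exponent and squares the bound, whence the powers of
    2; the first squaring removes the negative sign. *)
Lemma qform_le_trace_power (c : R) (y : 'I_n -> R) (m : nat) :
  0 <= c -> 0 < \sum_i y i ^+ 2 -> qform M y <= - (c * \sum_i y i ^+ 2) ->
  c ^+ (2 ^ m.+1) <= \tr (M ^+ (2 ^ m.+1)).
Proof.
set Y := \sum_i _ => c0 Y0 hy.
have e k : (2 ^ k.+1 = 2 ^ k + 2 ^ k)%N by rewrite expnS mul2n addnn.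
have sq k x : 0 <= x -> x * Y <= `|qform (M ^+ (2 ^ k)) y| ->
    x ^+ 2 * Y <= qform (M ^+ (2 ^ k.+1)) y.
  move=> x0 hx; rewrite -(ler_pM2l Y0) e (le_trans _ (qform_power_sqr _ _)) //.
  rewrite [leLHS](_ : _ = (x * Y) ^+ 2); last by ring.
  by rewrite -[leRHS]real_normK ?num_real // lerXn2r ?nnegrE // mulr_ge0 // ltW.
have low k : c ^+ (2 ^ k.+1) * Y <= qform (M ^+ (2 ^ k.+1)) y.
  elim: k => [|k IHk]; rewrite [X in c ^+ X]expnSr exprM; apply: sq; rewrite ?exprn_ge0 //.
    rewrite expn0 !expr1 -normrN (le_trans _ (ler_norm _)) //.
    by rewrite lerNr.
  by rewrite (le_trans IHk) // ler_norm.
rewrite -(ler_pM2r Y0) (le_trans (low m)) // mulrC e.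
exact: qform_even_power_le_trace.
Qed.
End SymmetricPowers.

(** * The second eigenvalue of a real symmetric matrix *)

Section RealSpectrum.
Variables (R : realType) (n : nat) (A : 'M[R]_n).
Hypothesis Asym : forall i j, A i j = A j i.
Local Notation C := (R[i]).
Local Notation AC := (map_mx (real_complex R) A).
Local Open Scope sesquilinear_scope.

Lemma Re_sum (I : finType) (F : I -> C) :
  complex.Re (\sum_i F i) = \sum_i complex.Re (F i).
Proof. by apply: (big_morph (@complex.Re R)) => // -[a b] [c d]. Qed.

Lemma Im_sum (I : finType) (F : I -> C) :
  complex.Im (\sum_i F i) = \sum_i complex.Im (F i).
Proof. by apply: (big_morph (@complex.Im R)) => // -[a b] [c d]. Qed.

(** Over C the matrix is Hermitian, so the spectral theorem gives a unitary [P] and real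
    eigenvalues. *)
Lemma real_sym_unitary_diag : exists (P : 'M[C]_n) (d : 'I_n -> R),
  [/\ P \in unitmx, invmx P = P^t* &
      AC = invmx P *m diag_mx (\row_i (d i)%:C%C) *m P].
Proof.
have hA : AC \is hermsymmx.
  apply: realsym_hermsym.
    by apply/is_hermitianmxP; rewrite expr0 scale1r; apply/matrixP => i j; rewrite !mxE Asym.
  by apply/mxOverP => i j; rewrite mxE; apply/complex_realP; exists (A i j).
have hr := hermitian_spectral_diag_real hA.
have /orthomx_spectralP e := hermitian_normalmx hA.
exists (spectralmx AC), (fun i => complex.Re (spectral_diag AC 0 i)); split.
- exact: spectral_unit.
- exact/invmx_unitary/spectral_unitarymx.
rewrite {1}e; congr (_ *m diag_mx _ *m _); apply/rowP => i; rewrite mxE.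
by rewrite RRe_real //; apply: (mxOverP hr).
Qed.

Lemma char_poly_unitary_diag (P : 'M[C]_n) (d : 'I_n -> R) :
  P \in unitmx -> AC = invmx P *m diag_mx (\row_i (d i)%:C%C) *m P ->
  char_poly A = \prod_(x <- [seq d i | i <- enum 'I_n]) ('X - x%:P).
Proof.
move=> uP e; apply: (map_poly_inj (real_complex R)).
rewrite map_char_poly e rmorph_prod big_map big_enum /=.
set D := diag_mx _.
transitivity (char_poly D).
  rewrite /char_poly.
  have -> : char_poly_mx (invmx P *m D *m P) =
     map_mx polyC (invmx P) *m char_poly_mx D *m map_mx polyC P.
    rewrite /char_poly_mx mulmxBr mulmxBl !map_mxM; congr (_ - _).
    by rewrite scalar_mxC -mulmxA -map_mxM mulVmx // map_mx1 mulmx1.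
  rewrite !det_mulmx mulrAC -det_mulmx -map_mxM mulVmx //.
  by rewrite map_mx1 det1 mul1r.
rewrite char_poly_trig ?diag_mx_is_trig //; apply: eq_bigr => i _.
by rewrite !mxE eqxx mulr1n rmorphB /= map_polyX map_polyC.
Qed.

Lemma sorted_spectrum_exists : exists s, is_sorted_spectrum A s.
Proof.
have [P [d [uP _ e]]] := real_sym_unitary_diag.
exists (sort <=%R [seq d i | i <- enum 'I_n]); split.
  exact: sort_sorted le_total _.
rewrite (char_poly_unitary_diag uP e).
by apply: perm_big; rewrite perm_sym perm_sort.
Qed.

(** Existence of a sorted spectrum ensures that the [epsilon] in [sorted_eigenvalues] selects
    one. *)
Lemma sorted_eigenvaluesP : is_sorted_spectrum A (sorted_eigenvalues A).
Proof. exact: epsilon_spec sorted_spectrum_exists. Qed.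

(** The cross terms between real and imaginary parts are purely imaginary, so a complex test vector
    splits into two real ones. *)
Lemma Re_conj_qform (B : 'M[R]_n) (z : 'rV[C]_n) :
  complex.Re ((z *m map_mx (real_complex R) B *m z^t*) 0 0) =
  qform B (fun i => complex.Re (z 0 i)) + qform B (fun i => complex.Im (z 0 i)).
Proof.
rewrite mxE Re_sum /qform exchange_big /= [X in _ = _ + X]exchange_big -big_split /=.
apply: eq_bigr => j _; rewrite !mxE mulr_suml Re_sum -big_split /=.
apply: eq_bigr => i _; rewrite !mxE.
case: (z 0 i) (z 0 j) => [a b] [c d]; rewrite /Num.conj /= /real_complex_def.
ring.
Qed.

(** Two eigenvectors span a plane, which contains a nonzero vector orthogonal to [f]. It is complex,
    and its real or imaginary part is the required [y]. *)
Lemma two_low_eigenvalues_test_vector (P : 'M[C]_n) (d f : 'I_n -> R) (c : R) i j :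
  P \in unitmx -> invmx P = P^t* ->
  AC = invmx P *m diag_mx (\row_i (d i)%:C%C) *m P ->
  i != j -> d i <= c -> d j <= c ->
  exists y : 'I_n -> R, [/\ 0 < \sum_i y i ^+ 2, \sum_i y i * f i = 0 &
    qform A y <= c * \sum_i y i ^+ 2].
Proof.
move=> uP iP e ij di dj.
pose g : 'cV[C]_n := P *m \col_k (f k)%:C%C.
(* In eigencoordinates [g] represents [f]; [w] is supported on [i] and [j], and its two coefficients
   solve the single equation w g = 0. *)
have [w w0 [wg wd]] : exists2 w : 'rV[C]_n, w != 0 &
    w *m g = 0 /\ forall k, w 0 k = 0 \/ d k <= c.
  pose W (a b : C) : 'rV[C]_n := a *: delta_mx 0 i + b *: delta_mx 0 j.
  have Wd a b k : W a b 0 k = 0 \/ d k <= c.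
    rewrite !mxE /=; have [->|_] := eqVneq k i; first by right.
    by have [->|_] := eqVneq k j; [right|left; rewrite !mulr0 addr0].
  have Wg a b : W a b *m g = (a * g i 0 + b * g j 0)%:M.
    apply/matrixP => x y; rewrite !ord1 mulmxDl -!scalemxAl -!rowE !mxE.
    by rewrite eqxx mulr1n.
  have Wi a b : W a b 0 i = a by rewrite !mxE !eqxx (negPf ij) !mulr1 mulr0 addr0.
  have Wj a b : W a b 0 j = b.
    by rewrite !mxE !eqxx eq_sym (negPf ij) !mulr1 mulr0 add0r.
  have [gi|gi] := eqVneq (g i 0) 0.
    exists (W 1 0); last by rewrite Wg gi mulr0 mul0r addr0 raddf0.
    by apply/eqP => /rowP/(_ i)/eqP; rewrite Wi mxE oner_eq0.
  exists (W (- g j 0) (g i 0)); last first.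
    by rewrite Wg mulNr mulrC addrC subrr raddf0.
  by apply/eqP => /rowP/(_ j)/eqP; rewrite Wj [X in _ == X]mxE (negPf gi).
pose z := w *m P.
have zstar : z^t* = invmx P *m w^t* by rewrite trmx_mul map_mxM iP.
have zA : z *m AC *m z^t* = w *m diag_mx (\row_i (d i)%:C%C) *m w^t*.
  by rewrite zstar e /z !mulmxA !mulmxK.
have zz : z *m z^t* = w *m w^t* by rewrite zstar /z mulmxA mulmxK.
pose x k := complex.Re (z 0 k); pose y k := complex.Im (z 0 k).
have q1 u : qform 1%:M u = \sum_k u k ^+ 2.
  apply: eq_bigr => k _; rewrite (bigD1 k) //= big1 => [|l /negPf lk].
    by rewrite mxE eqxx mulr1 addr0 expr2.
  by rewrite mxE eq_sym lk mulr0 mul0r.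
have hz : qform A x + qform A y <= c * (\sum_k x k ^+ 2 + \sum_k y k ^+ 2).
  rewrite -!q1 -!Re_conj_qform zA map_mx1 mulmx1 zz !mxE !Re_sum mulr_sumr.
  apply: ler_sum => k _; rewrite mul_mx_diag !mxE.
  case: (wd k) => [->|dk]; first by rewrite !mul0r mulr0.
  case: (w 0 k) => [a b]; rewrite /Num.conj /= /real_complex_def.
  have := ler_wpM2r (addr_ge0 (sqr_ge0 a) (sqr_ge0 b)) dk; nra.
have zf : \sum_k z 0 k * (f k)%:C%C = 0.
  have /matrixP/(_ 0 0) := wg; rewrite /g mulmxA -/z [LHS]mxE [RHS]mxE => zg; rewrite -[RHS]zg.
  by apply: eq_bigr => k _; congr (_ * _); rewrite mxE.
have xf : \sum_k x k * f k = 0.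
  rewrite -[RHS]/(complex.Re (0 : C)) -zf Re_sum.
  apply: eq_bigr => k _; rewrite /x; case: (z 0 k) => [a b] /=; ring.
have yf : \sum_k y k * f k = 0.
  rewrite -[RHS]/(complex.Im (0 : C)) -zf Im_sum.
  apply: eq_bigr => k _; rewrite /y; case: (z 0 k) => [a b] /=; ring.
have z0 : z != 0 by apply: contra w0 => /eqP z0; rewrite -[w](mulmxK uP) -/z z0 mul0mx.
have ge0 u : 0 <= \sum_(k < n) u k ^+ 2 :> R by apply: sumr_ge0 => k _; exact: sqr_ge0.
have null u : \sum_(k < n) u k ^+ 2 = 0 -> forall k, u k = 0 :> R.
  move=> /eqP; rewrite psumr_eq0 => [/allP h k|k _]; last exact: sqr_ge0.
  by have := h k; rewrite mem_index_enum sqrf_eq0 => /(_ isT)/eqP.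
(* [hz] bounds the sum of the two forms, so one of [x], [y] meets its own bound; if one of them is
   0, the other is taken, and [z0] keeps both from vanishing. *)
have [x0|x0] := leP (\sum_k x k ^+ 2) 0; last first.
  have [y0|y0] := leP (\sum_k y k ^+ 2) 0; last first.
    have [hx|hx] := leP (qform A x) (c * \sum_k x k ^+ 2); first by exists x.
    exists y; split => //; move: hz hx; rewrite mulrDr; lra.
  exists x; split => //; have y0' : \sum_k y k ^+ 2 = 0 by apply/eqP; rewrite eq_le y0 ge0.
  move: hz; rewrite y0' addr0; congr (_ <= _).
  rewrite [X in _ + X]big1 ?addr0 // => k _; rewrite big1 // => l _.
  by rewrite (null _ y0') !mul0r.
have x0' : \sum_k x k ^+ 2 = 0 by apply/eqP; rewrite eq_le x0 ge0.
exists y; split => //; last first.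
  move: hz; rewrite x0' add0r; congr (_ <= _).
  rewrite [X in X + _]big1 ?add0r // => k _; rewrite big1 // => l _.
  by rewrite (null _ x0') !mul0r.
rewrite lt_def ge0 andbT; apply: contra z0 => /eqP y0'; apply/eqP/rowP => k.
rewrite [RHS]mxE; have := null _ x0' k; have := null _ y0' k; rewrite /x /y.
by case: (z 0 k) => [a b] /= -> ->.
Qed.

(** One direction of Courant-Fischer: two eigenvalues at most [c] would give a test vector violating
    the hypothesis. *)
Lemma lambda2_gt (f : 'I_n -> R) (c : R) :
  (1 < n)%N ->
  (forall y : 'I_n -> R, 0 < \sum_i y i ^+ 2 -> \sum_i y i * f i = 0 ->
    c * \sum_i y i ^+ 2 < qform A y) ->
  c < lambda2 A.
Proof.
move=> n1 hf; rewrite ltNge; apply/negP => low.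
have [P [d [uP iP e]]] := real_sym_unitary_diag.
have [srt cp] := sorted_eigenvaluesP.
rewrite (char_poly_unitary_diag uP e) in cp.
have pm := prod_XsubC_eq cp; move: low srt pm; rewrite /lambda2.
(* The list has n > 1 entries, so [nth] in [lambda2] does not fall back on its default 0. *)
case: (sorted_eigenvalues A) => [|s0 [|s1 s]] low srt pm.
- by move: n1 (perm_size pm); rewrite size_map -cardE card_ord /= => + n0; rewrite n0.
- by move: n1 (perm_size pm); rewrite size_map -cardE card_ord /= => + n0; rewrite n0.
have s01 : s0 <= s1 by case/andP: srt.
(* Counting the entries at most [c] on both sides of the permutation gives two distinct indices,
   even for a multiple eigenvalue. *)
have /permP/(_ (fun x => x <= c)) := pm.
rewrite count_map /= low (le_trans s01 low) !add1n => cnt.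
have : (1 < #|[set i | (d i <= c)%R]|)%N.
  by rewrite cardsE cardE /enum_mem size_filter -enumT; move: cnt => /=; case: (count _ _) => [|[]].
case/card_gt1P => i [j [di dj ij]]; rewrite !inE in di dj.
have [y [y0 yf hy]] := two_low_eigenvalues_test_vector f uP iP e ij di dj.
by have := hf y y0 yf; rewrite ltNge hy.
Qed.
End RealSpectrum.

(** * Counting edges of the link graph *)

Lemma sum_bool_card (T : finType) (A b : pred T) :
  (\sum_(x | A x) b x = #|[set x | A x && b x]|)%N.
Proof. by rewrite -sum1dep_card big_mkcondr. Qed.

Section LinkCounting.
Variable n : nat.
Implicit Types (v w : letter n) (r : word n) (Rel : {set word n}).

Definition rel_adj r v w : nat :=
  let: (a, b, c) := r in
  edge_mult a (linv b) v w + edge_mult b (linv c) v w + edge_mult c (linv a) v w.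

Definition rel_deg r v : nat := \sum_w rel_adj r v w.

Lemma link_adjE Rel v w : link_adj Rel v w = \sum_(r in Rel) rel_adj r v w.
Proof. by []. Qed.

Lemma link_degE Rel v : link_deg Rel v = \sum_(r in Rel) rel_deg r v.
Proof. by rewrite /link_deg exchange_big. Qed.

Lemma edge_multC (x y v w : letter n) : edge_mult x y v w = edge_mult x y w v.
Proof. by rewrite /edge_mult addnC (andbC (v == y)) (andbC (v == x)). Qed.

Lemma rel_adjC r v w : rel_adj r v w = rel_adj r w v.
Proof. by case: r => [[a b] c]; rewrite /rel_adj !(edge_multC _ _ v). Qed.

Lemma link_adjC Rel v w : link_adj Rel v w = link_adj Rel w v.
Proof. by rewrite !link_adjE; apply: eq_bigr => r _; exact: rel_adjC. Qed.

Lemma linvK : involutive (@linv n).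
Proof. by case=> i b; rewrite /linv /= negbK. Qed.

Lemma card_letter : #|{: letter n}| = n.*2.
Proof. by rewrite card_prod card_ord card_bool muln2. Qed.

(** The three conditions of cyclic reduction say exactly that none of the three edges is a loop. *)
Lemma rel_adj_loop r v : r \in candidates n -> rel_adj r v v = 0%N.
Proof.
case: r => [[a b] c]; rewrite inE => /and3P[ab bc ca].
have h x y : x != y -> edge_mult x y v v = 0%N.
  move=> xy; rewrite /edge_mult (andbC (v == y)) addnn.
  by apply/eqP; rewrite double_eq0 eqb0; apply: contra xy => /andP[/eqP<- /eqP<-].
by rewrite /rel_adj !h.
Qed.

Lemma link_adj_loop Rel v : Rel \subset candidates n -> link_adj Rel v v = 0%N.
Proof. 
move=> /subsetP sub; rewrite link_adjE big1 // => r rR.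
by rewrite rel_adj_loop ?sub.
Qed.

Lemma rel_deg_le r v : (rel_deg r v <= 6)%N.
Proof.
have h x y : (\sum_w edge_mult x y v w <= 2)%N.
  rewrite big_split /=; apply: (@leq_add _ _ 1 1).
    rewrite (bigD1 y) //= big1 => [|w /negPf ->]; rewrite ?andbF //.
    by rewrite addn0 leq_b1.
  rewrite (bigD1 x) //= big1 => [|w /negPf ->]; rewrite ?andbF //.
  by rewrite addn0 leq_b1.
case: r => [[a b] c]; rewrite /rel_deg /rel_adj /= 2!big_split.
by apply: (@leq_add _ _ 4 2); first apply: (@leq_add _ _ 2 2); exact: h.
Qed.

(** The first edge with an orientation; the rotations [rotw] bring the other two edges to this
    position. *)
Let first_edge r v w : bool := (v == r.1.1) && (w == linv r.1.2).
Let rotw r : word n := (r.1.2, r.2, r.1.1).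

(** The edge determines a = v and b = w^-1, and c must avoid w and v^-1, which coincide when w =
    v^-1. *)
Lemma first_edge_count v w :
  (\sum_(r in candidates n) first_edge r v w =
   (v != w) * (n.*2 - 2 + (w == linv v)))%N.
Proof.
rewrite sum_bool_card.
have -> : [set r | (r \in candidates n) && first_edge r v w] =
    [set (v, linv w, c) | c in [set c | cyc_reduced (v, linv w, c)]].
  apply/setP => -[[a b] c]; rewrite !inE /first_edge /=; apply/idP/imsetP.
    move=> /andP[abc /andP[/eqP va /eqP wb]]; exists c; rewrite ?va ?wb ?linvK //.
    by rewrite inE.
  by move=> [c']; rewrite inE => h [-> -> ->]; rewrite h linvK !eqxx.
rewrite card_imset => [|c c' [] //].
have [->|vw] := eqVneq v w.
  by rewrite mul0n; apply: eq_card0 => c; rewrite !inE /= linvK eqxx.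
have -> : [set c | cyc_reduced (v, linv w, c)] = ~: [set w; linv v].
  apply/setP => c; rewrite !inE /= linvK vw /= negb_or; congr (_ && _).
  by rewrite (inj_eq (inv_inj linvK)) eq_sym.
have := cardsC [set w; linv v]; rewrite cards2 card_letter.
by case: (w == linv v) => /=; lia.
Qed.

(** Three edges in two orientations give six sums; rotation permutes the candidates, so each reduces
    to [first_edge_count]. *)
Lemma link_adj_candidates v w :
  (link_adj (candidates n) v w = 6 * ((v != w) * (n.*2 - 2 + (w == linv v))))%N.
Proof.
have rot_inj : injective rotw.
  by move=> [[a b] c] [[a' b'] c'] [-> -> ->].
have rot_cand r : (rotw r \in candidates n) = (r \in candidates n).
  case: r => [[a b] c]; rewrite !inE /=.
  by rewrite andbA andbC.
have rotX x y : (\sum_(r in candidates n) first_edge (rotw r) x y =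
    \sum_(r in candidates n) first_edge r x y)%N.
  by rewrite [RHS](reindex_inj rot_inj) /=; apply: eq_bigl => r; rewrite rot_cand.
have rotX2 x y : (\sum_(r in candidates n) first_edge (rotw (rotw r)) x y =
    \sum_(r in candidates n) first_edge r x y)%N.
  rewrite -[RHS]rotX [RHS](reindex_inj rot_inj) /=.
  by apply: eq_bigl => r; rewrite rot_cand.
rewrite link_adjE (eq_bigr (fun r => first_edge r v w + first_edge r w v +
   (first_edge (rotw r) v w + first_edge (rotw r) w v) +
   (first_edge (rotw (rotw r)) v w + first_edge (rotw (rotw r)) w v)))%N; last first.
  move=> [[a b] c] _; rewrite /rel_adj /edge_mult /first_edge /=.
  by rewrite ![(v == linv _) && _]andbC.
rewrite !big_split /= !rotX !rotX2 !first_edge_count [w == v]eq_sym.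
have -> : (v == linv w) = (w == linv v) by rewrite -(inv_eq linvK) eq_sym.
lia.
Qed.

Lemma link_deg_candidates v : (0 < n)%N ->
  link_deg (candidates n) v = (6 * ((n.*2 - 2) * n.*2.-1 + 1))%N.
Proof.
move=> n0; rewrite /link_deg; under eq_bigr do rewrite link_adj_candidates.
rewrite -big_distrr /=; congr (6 * _)%N.
rewrite (eq_bigr (fun w => (v != w) * (n.*2 - 2) + (w == linv v))%N); last first.
  move=> w _; rewrite mulnDr; congr (_ + _)%N.
  have [->|_] := eqVneq w (linv v); last by rewrite muln0.
  have -> // : v != linv v by apply/eqP => /(congr1 snd) /=; case: (v.2).
rewrite big_split /= -big_distrl /= mulnC; congr (_ * _ + _)%N.
  rewrite sum_bool_card -card_letter -(cardsC1 v); apply: eq_card => w.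
  by rewrite !inE eq_sym.
by rewrite (bigD1 (linv v)) //= eqxx big1 ?addn0 // => w /negPf ->.
Qed.
End LinkCounting.

(** * The form D/2 - A *)

Lemma qformD (R : realFieldType) n (A B : 'M[R]_n) y :
  qform (A + B) y = qform A y + qform B y.
Proof.
rewrite /qform -big_split; apply: eq_bigr => i _ /=; rewrite -big_split.
by apply: eq_bigr => j _ /=; rewrite mxE; ring.
Qed.

Lemma qformZ (R : realFieldType) n (a : R) (A : 'M[R]_n) y :
  qform (a *: A) y = a * qform A y.
Proof.
rewrite /qform mulr_sumr; apply: eq_bigr => i _; rewrite mulr_sumr.
by apply: eq_bigr => j _; rewrite mxE; ring.
Qed.

Section HalfLaplacian.
Variables (R : realType) (n : nat).
Local Notation N := #|{: letter n}|.
Implicit Types (Rel : {set word n}) (r : word n) (y : 'I_N -> R).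

(** The matrix Q_r: the share of one relator in D/2 - A. *)
Definition rel_half_lap r : 'M[R]_N :=
  \matrix_(i, j) ((i == j)%:R * (rel_deg r (enum_val i))%:R / 2
                  - (rel_adj r (enum_val i) (enum_val j))%:R).

Definition half_lap Rel : 'M[R]_N := \sum_(r in Rel) rel_half_lap r.

Lemma half_lapE Rel i j : half_lap Rel i j =
  (i == j)%:R * (link_deg Rel (enum_val i))%:R / 2
  - (link_adj Rel (enum_val i) (enum_val j))%:R.
Proof.
rewrite summxE link_degE link_adjE !natr_sum mulr_sumr mulr_suml -sumrB.
by apply: eq_bigr => r _; rewrite mxE.
Qed.

Lemma sum_letters (T : nmodType) (F : letter n -> T) :
  \sum_(i < N) F (enum_val i) = \sum_v F v.
Proof. by rewrite -big_enum_val. Qed.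

Lemma rel_half_lap_sym r i j : rel_half_lap r i j = rel_half_lap r j i.
Proof.
by rewrite !mxE rel_adjC [j == i]eq_sym; case: eqVneq => [->|] //; rewrite !mul0r.
Qed.

(** The constant is 1/2 from the diagonal plus 1 from the adjacency row. *)
Lemma rel_half_lap_row r i :
  \sum_j `|rel_half_lap r i j| <= 3 / 2 * (rel_deg r (enum_val i))%:R.
Proof.
have -> : 3 / 2 * (rel_deg r (enum_val i))%:R =
    \sum_j ((i == j)%:R * (rel_deg r (enum_val i))%:R / 2
      + (rel_adj r (enum_val i) (enum_val j))%:R) :> R.
  rewrite big_split /= -natr_sum (sum_letters (fun v => rel_adj r (enum_val i) v)).
  rewrite -/(rel_deg _ _) (bigD1 i) //= big1 => [|j /negPf].
    by rewrite eqxx /=; lra.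
  by rewrite eq_sym => ->; rewrite !mul0r.
apply: ler_sum => j _; rewrite mxE (le_trans (ler_normB _ _)) // !ger0_norm //.
by rewrite divr_ge0 ?mulr_ge0.
Qed.

Lemma qform_half_lap Rel y : qform (half_lap Rel) y =
  \sum_(i < N) (link_deg Rel (enum_val i))%:R / 2 * y i ^+ 2 -
  \sum_i \sum_j y i * (link_adj Rel (enum_val i) (enum_val j))%:R * y j.
Proof.
rewrite -sumrB; apply: eq_bigr => i _.
under eq_bigr do rewrite half_lapE mulrBr mulrBl.
rewrite sumrB; congr (_ - _); rewrite (bigD1 i) //= big1 => [|j /negPf].
  by rewrite eqxx /=; ring.
by rewrite eq_sym => -> /=; ring.
Qed.

(** * From positivity on sum-zero vectors to the normalized Laplacian *)

Section PositiveOnSumZero.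
Variable Rel : {set word n}.
Hypotheses (n0 : (0 < n)%N) (subRel : Rel \subset candidates n).
Hypothesis pos : forall y, 0 < \sum_i y i ^+ 2 -> \sum_i y i = 0 ->
  0 < qform (half_lap Rel) y.

(* An isolated vertex v would make e_v - 1/N a vector with nonpositive form. *)
Lemma link_deg_gt0 (i : 'I_N) : (0 < link_deg Rel (enum_val i))%N.
Proof.
rewrite lt0n; apply/negP => /eqP di0.
have N0 : (0 < N)%N by rewrite card_letter double_gt0.
have NR : N%:R != 0 :> R by rewrite pnatr_eq0 -lt0n.
pose y j : R := (j == i)%:R - N%:R^-1.
have adj0 j : link_adj Rel (enum_val i) (enum_val j) = 0%N.
  apply/eqP; move/eqP: di0; rewrite /link_deg sum_nat_eq0 => /forallP.
  by move/(_ (enum_val j)).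
have yc j : y j = - N%:R^-1 \/ j = i.
  by rewrite /y; have [|_] := eqVneq j i; [right|left; rewrite sub0r].
have sumy : \sum_j y j = 0.
  rewrite sumrB sumr_const card_ord -[X in _ - X]mulr_natl divff //.
  by rewrite (bigD1 i) //= eqxx big1 ?addr0 ?subrr // => j /negPf ->.
have y2 : 0 < \sum_j y j ^+ 2.
  rewrite (bigD1 i) //= ltr_wpDr ?sumr_ge0 // => [j _|]; first exact: sqr_ge0.
  rewrite exprn_even_gt0 //= /y eqxx subr_eq0 eq_sym invr_eq1 pnatr_eq1.
  by rewrite card_letter; case: (n) n0.
have := pos y2 sumy; rewrite qform_half_lap.
(* Terms involving [i] vanish and [y] is -1/N elsewhere, so the form is -1/2 times the total degree
   over N^2. *)
have -> : \sum_(j < N) (link_deg Rel (enum_val j))%:R / 2 * y j ^+ 2 =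
    \sum_(j < N) (link_deg Rel (enum_val j))%:R / 2 * N%:R^-1 ^+ 2.
  apply: eq_bigr => j _; case: (yc j) => ->; first by rewrite sqrrN.
  by rewrite di0 !mul0r.
have -> : \sum_j \sum_k y j * (link_adj Rel (enum_val j) (enum_val k))%:R * y k =
    \sum_(j < N) (link_deg Rel (enum_val j))%:R * N%:R^-1 ^+ 2.
  apply: eq_bigr => j _.
  rewrite /link_deg -(sum_letters (fun v => link_adj Rel (enum_val j) v)) natr_sum.
  rewrite mulr_suml; apply: eq_bigr => k _.
  case: (yc j) => [->|->]; last by rewrite adj0 mulr0 !mul0r.
  case: (yc k) => [->|->]; last by rewrite link_adjC adj0 mulr0 !mul0r.
  by ring.
rewrite -sumrB ltNge => /negP; apply; apply: sumr_le0 => j _.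
rewrite -mulrBl mulr_le0_ge0 ?sqr_ge0 //.
have : 0 <= (link_deg Rel (enum_val j))%:R :> R by []; lra.
Qed.

(* Substituting y = D^(-1/2) x turns the form of the normalized Laplacian into
   that of D - A. *)
Lemma lambda2_norm_laplacian_gt_half : 1 / 2 < lambda2 (norm_laplacian R Rel).
Proof.
pose d (i : 'I_N) : R := Num.sqrt (link_deg Rel (enum_val i))%:R.
have d0 i : 0 < d i by rewrite sqrtr_gt0 ltr0n link_deg_gt0.
have d2 i : d i ^+ 2 = (link_deg Rel (enum_val i))%:R by rewrite sqr_sqrtr.
have lapE i j : norm_laplacian R Rel i j =
    (i == j)%:R - (link_adj Rel (enum_val i) (enum_val j))%:R / (d i * d j).
  rewrite mxE /= link_deg_gt0; have [->|_] := eqVneq i j.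
    by rewrite link_adj_loop // mul0r subr0.
  rewrite sqrtrM // -/(d i) -/(d j) sub0r mulNr.
  by case: posnP => // ->; rewrite mul0r oppr0.
apply: (@lambda2_gt _ _ _ _ (fun i => (d i)^-1)).
- by move=> i j; rewrite !lapE link_adjC [j == i]eq_sym [d j * _]mulrC.
- by rewrite card_letter; lia.
move=> x x2 xf; pose y i := x i / d i.
have y2 : 0 < \sum_i y i ^+ 2.
  rewrite lt_def sumr_ge0 ?andbT => [|i _]; last exact: sqr_ge0.
  rewrite psumr_eq0 => [|i _]; last exact: sqr_ge0.
  apply: contraL x2 => /allP y0; rewrite -leNgt; apply: sumr_le0 => i _.
  have := y0 i; rewrite mem_index_enum sqrf_eq0 mulf_eq0 invr_eq0.
  by rewrite (gt_eqF (d0 i)) orbF => /(_ isT)/eqP ->; rewrite expr0n.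
have := pos y2 xf; rewrite qform_half_lap.
have -> : \sum_(i < N) (link_deg Rel (enum_val i))%:R / 2 * y i ^+ 2 =
    1 / 2 * \sum_i x i ^+ 2.
  rewrite mulr_sumr; apply: eq_bigr => i _; rewrite -d2 /y.
  by have := d0 i => /gt_eqF/negbT ?; field.
rewrite subr_gt0 => hy.
have -> : qform (norm_laplacian R Rel) x = \sum_i x i ^+ 2 -
    \sum_i \sum_j y i * (link_adj Rel (enum_val i) (enum_val j))%:R * y j.
  rewrite -sumrB; apply: eq_bigr => i _.
  rewrite [X in X - _](_ : _ = \sum_j x i * (i == j)%:R * x j).
    rewrite -sumrB; apply: eq_bigr => j _; rewrite lapE /y.
    have /gt_eqF/negbT di := d0 i; have /gt_eqF/negbT dj := d0 j.
    by field; rewrite di dj.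
  rewrite (bigD1 i) //= big1 => [|j /negPf]; first by rewrite eqxx /=; ring.
  by rewrite eq_sym => -> /=; ring.
lra.
Qed.
End PositiveOnSumZero.

(** The common degree t of the vertices when all candidates are chosen; the expected degree is p
    t. *)
Definition mean_deg : nat := (6 * ((n.*2 - 2) * n.*2.-1 + 1))%N.

(** Here A = 6 (c (J - I) + S) with c = 2n - 2, J the all-ones matrix and S the permutation v ->
    v^-1. On sum-zero vectors J drops out and S is at most I, so the form of A is at most 6 (1 - c)
    |y|^2 <= 0. *)
Lemma qform_half_lap_candidates y : (1 < n)%N -> \sum_i y i = 0 ->
  mean_deg%:R / 2 * \sum_i y i ^+ 2 <= qform (half_lap (candidates n)) y.
Proof.
move=> n1 y0; rewrite qform_half_lap.
under [X in _ <= X - _]eq_bigr do rewrite link_deg_candidates ?(ltnW n1) //.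
rewrite -mulr_sumr -/mean_deg lerBrDr gerDl.
pose c : R := (n.*2 - 2)%:R.
pose s (i : 'I_N) : 'I_N := enum_rank (linv (enum_val i)).
have sK : involutive s by move=> i; rewrite /s enum_rankK linvK enum_valK.
have sE (i j : 'I_N) : (enum_val j == linv (enum_val i)) = (j == s i).
  by rewrite -(inj_eq enum_val_inj) /s enum_rankK.
have si i : s i != i.
  rewrite -(inj_eq enum_val_inj) enum_rankK; apply/eqP => /(congr1 snd) /=.
  by case: (enum_val i).2.
have -> : \sum_i \sum_j y i * (link_adj (candidates n) (enum_val i) (enum_val j))%:R * y j
  = \sum_i (6 * c * (y i * \sum_j y j) - 6 * c * y i ^+ 2 + 6 * (y i * y (s i))).
  apply: eq_bigr => i _; rewrite mulr_sumr mulr_sumr.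
  rewrite [X in _ - X](_ : _ = \sum_j (if j == i then 6 * c * y i ^+ 2 else 0)); last first.
    by rewrite -big_mkcond big_pred1_eq.
  rewrite [X in _ = _ + X](_ : _ = \sum_j (if j == s i then 6 * (y i * y (s i)) else 0)); last first.
    by rewrite -big_mkcond big_pred1_eq.
  rewrite -sumrB -big_split /=; apply: eq_bigr => j _.
  rewrite link_adj_candidates (inj_eq enum_val_inj) sE natrM natrM natrD -/c.
  rewrite [i == j]eq_sym.
  have [->|ji] := eqVneq j i; first by rewrite eq_sym (negPf (si i)) /=; ring.
  by have [->|_] := eqVneq j (s i) => /=; ring.
rewrite y0; under eq_bigr do rewrite !mulr0 sub0r.
rewrite big_split sumrN /= -!mulr_sumr.
have cs : \sum_i y i * y (s i) <= \sum_i y i ^+ 2.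
  have : 0 <= \sum_i (y i - y (s i)) ^+ 2 by apply: sumr_ge0 => i _; exact: sqr_ge0.
  have -> : \sum_i (y i - y (s i)) ^+ 2 =
      \sum_i y i ^+ 2 + \sum_i y (s i) ^+ 2 - 2 * \sum_i y i * y (s i).
    by rewrite mulr_sumr -big_split -sumrB; apply: eq_bigr => i _ /=; ring.
  have <- : \sum_i y i ^+ 2 = \sum_i y (s i) ^+ 2 by rewrite (reindex_inj (inv_inj sK)).
  lra.
have c1 : 1 <= c by rewrite /c ler1n; lia.
have y2 : 0 <= \sum_i y i ^+ 2 by apply: sumr_ge0 => i _; exact: sqr_ge0.
have := ler_wpM2r y2 c1; lra.
Qed.
End HalfLaplacian.

(** * Concentration of the form D/2 - A *)

Section FailureProbability.
Variables (R : realType) (n : nat) (p : R).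
Hypothesis p01 : 0 <= p <= 1.

(** Probability 0 outside the candidates lets the Bernoulli sums run over all words. *)
Definition rel_prob (r : word n) : R := if r \in candidates n then p else 0.

Lemma rel_prob01 r : 0 <= rel_prob r <= 1.
Proof. by rewrite /rel_prob; case: ifP; rewrite ?lexx ?ler01. Qed.

Lemma gamma_probE (E : {set word n} -> bool) :
  gamma_prob p E = \sum_(J : {set word n} | (J \subset candidates n) && E J)
    bern_weight rel_prob J.
Proof.
apply: eq_bigr => J /andP[/[dup] JC /subsetP JCP _].
rewrite /bern_weight (bigID (mem J)) /=; congr (_ * _).
  rewrite (eq_bigr (fun=> p)) ?prodr_const // => r rJ.
  by rewrite rJ /rel_prob JCP.
rewrite (bigID (mem (candidates n))) /= [X in _ * X]big1 ?mulr1 => [|r].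
  rewrite (eq_bigr (fun=> 1 - p)) => [|r /andP[/negPf -> rC]]; last first.
    by rewrite /rel_prob rC.
  rewrite prodr_const; congr (_ ^+ _).
  rewrite -[in LHS](setIidPr JC) -cardsD; apply: eq_card => r.
  by rewrite in_setD.
by move=> /andP[/negPf -> /negPf rC]; rewrite /rel_prob rC subr0.
Qed.

Lemma bern_weight_notsub (J : {set word n}) :
  ~~ (J \subset candidates n) -> bern_weight rel_prob J = 0.
Proof.
case/subsetPn => r rJ /negPf rC.
by rewrite /bern_weight (bigD1 r) //= rJ /rel_prob rC mul0r.
Qed.

Let M (J : {set word n}) : 'M[R]_#|{: letter n}| :=
  \sum_r centred rel_prob J r *: rel_half_lap R r.

Lemma centred_half_lapE (J : {set word n}) :
  M J = half_lap R J - p *: half_lap R (candidates n).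
Proof.
rewrite /M /half_lap scaler_sumr [X in _ = X - _]big_mkcond.
rewrite [X in _ = _ - X]big_mkcond -sumrB; apply: eq_bigr => r _.
rewrite /centred /rel_prob scalerBl; congr (_ - _).
  by case: ifP => _; rewrite ?scale1r ?scale0r.
by case: ifP => _; rewrite ?scale0r.
Qed.

Lemma centred_half_lap_sym (J : {set word n}) i j : M J i j = M J j i.
Proof.
rewrite !summxE; apply: eq_bigr => r _.
by rewrite [LHS]mxE [RHS]mxE rel_half_lap_sym.
Qed.

Let t : R := (mean_deg n)%:R.

Lemma mean_rel_half_lap_row v : (0 < n)%N ->
  \sum_r rel_prob r * \sum_u `|rel_half_lap R r v u| <= 3 / 2 * (p * t).
Proof.
move=> n0; have p0 : 0 <= p by case/andP: p01.
rewrite (bigID (mem (candidates n))) /= [X in _ + X]big1 ?addr0 => [|r /negPf rC].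
  rewrite /t /mean_deg -(link_deg_candidates (enum_val v)) // link_degE natr_sum.
  rewrite !mulr_sumr; apply: ler_sum => r rC; rewrite /rel_prob rC mulrCA.
  by rewrite ler_wpM2l // rel_half_lap_row.
by rewrite /rel_prob rC mul0r.
Qed.

(** A sum-zero [y] with nonpositive form for [J] has centred form at most -(p t / 2)|y|^2, because
    the mean is at least (p t / 2)|y|^2; this forces a large trace. *)
Lemma lambda2_gt_half_of_trace (m : nat) (J : {set word n}) :
  (1 < n)%N -> J \subset candidates n ->
  \tr (M J ^+ (2 ^ m.+1)) < (p * t / 2) ^+ (2 ^ m.+1) ->
  1 / 2 < lambda2 (norm_laplacian R J).
Proof.
move=> n1 JC htr; have p0 : 0 <= p by case/andP: p01.
apply: lambda2_norm_laplacian_gt_half => // [|y y2 y0]; first exact: ltnW.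
rewrite ltNge; apply/negP => hy; move: htr; rewrite ltNge => /negP; apply.
apply: (qform_le_trace_power (centred_half_lap_sym J) m _ y2).
  by rewrite divr_ge0 // mulr_ge0 // ler0n.
rewrite centred_half_lapE qformD -scaleNr qformZ.
have := ler_wpM2l p0 (qform_half_lap_candidates n1 y0).
rewrite -/t; set Y := \sum_i y i ^+ 2 in y2 *; move: hy; lra.
Qed.

Lemma gamma_prob_lambda2_ge (m : nat) : (1 < n)%N ->
  1728 * (2 ^ m)%:R <= p * t ->
  1 - n.*2%:R / 4 ^+ (2 ^ m) <=
  gamma_prob p (fun J : {set word n} => 1 / 2 < lambda2 (norm_laplacian R J)).
Proof.
move=> n1; set k := (2 ^ m)%N => ptk.
have k0 : 0 < k%:R :> R by rewrite ltr0n expn_gt0.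
have pt0 : 0 < p * t by apply: lt_le_trans ptk; rewrite mulr_gt0.
have kk : (2 ^ m.+1 = k.*2)%N by rewrite expnS mul2n.
pose c := p * t / 2; pose w := bern_weight rel_prob.
have c0 : 0 < c by rewrite divr_gt0.
have w0 J : 0 <= w J by apply: bern_weight_ge0; exact: rel_prob01.
have trJ J : 0 <= \tr (M J ^+ k.*2).
  by rewrite -addnn; apply: trace_even_power_ge0; exact: centred_half_lap_sym.
(* Markov's inequality: a failing [J] of nonzero weight has trace at least [c ^+ k.*2]. *)
have fail : 1 - gamma_prob p (fun J : {set word n} => 1 / 2 < lambda2 (norm_laplacian R J)) <=
    bern_expect rel_prob (fun J => \tr (M J ^+ k.*2)) / c ^+ k.*2.
  rewrite gamma_probE -[X in X - _](bern_weight_sum rel_prob) lerBlDl.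
  rewrite (bigID (fun J : {set word n} => (J \subset candidates n) &&
     (1 / 2 < lambda2 (norm_laplacian R J)))) /= lerD2l.
  rewrite /bern_expect mulr_suml.
  rewrite [leRHS](bigID (fun J : {set word n} => (J \subset candidates n) &&
     (1 / 2 < lambda2 (norm_laplacian R J)))) /= ler_wpDl //.
    by apply: sumr_ge0 => J _; rewrite divr_ge0 ?mulr_ge0 ?exprn_ge0 ?(ltW c0) // w0.
  apply: ler_sum => J; rewrite negb_and => /orP[/bern_weight_notsub ->|hJ].
    by rewrite !mul0r.
  have [JC|/bern_weight_notsub ->] := boolP (J \subset candidates n); last first.
    by rewrite !mul0r.
  rewrite -mulrA ler_peMr ?w0 // ler_pdivlMr ?exprn_gt0 // mul1r leNgt.
  apply: contra hJ; rewrite -kk => h; exact: lambda2_gt_half_of_trace h.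
rewrite lerBlDr -lerBlDl (le_trans fail) // ler_pdivrMr ?exprn_gt0 //.
(* [lam] balances the two terms of the step cost: D / lam = 18k = 2k * 9, where 9 = 3/2 * 6 bounds a
   row sum of Q_r. *)
pose D := 3 / 2 * (p * t); pose lam := D / (18 * k%:R).
have lam1 : 1 <= lam by rewrite ler_pdivlMr ?mulr_gt0 // mul1r /D; lra.
have row9 (r : word n) v : \sum_u `|rel_half_lap R r v u| <= 9.
  rewrite (le_trans (rel_half_lap_row _ _ _)) //.
  have : (rel_deg r (enum_val v))%:R <= 6 :> R by rewrite ler_nat rel_deg_le.
  lra.
have := @trace_moment_le _ _ _ rel_prob01 _ k _ 9 _ _ lam1 (ler0n _ 9) row9
  (fun v => mean_rel_half_lap_row v (ltnW n1)).
rewrite -/D => /le_trans; apply; rewrite card_letter -[leRHS]mulrA ler_wpM2l ?ler0n //.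
have D0 : D != 0 by rewrite gt_eqF // /D; lra.
have kn0 : k%:R != 0 :> R by rewrite gt_eqF.
have -> : D / lam + k.*2%:R * 9 = 36 * k%:R.
  rewrite -muln2 natrM /lam; field; by rewrite D0 kn0.
rewrite -!mul2n !exprM -exprVn -!exprMn lerXn2r ?nnegrE //.
- by rewrite mulr_ge0 ?sqr_ge0 // (le_trans _ lam1).
- by rewrite mulr_ge0 ?sqr_ge0 ?invr_ge0 ?ler0n.
(* It remains to compare 108 k p t with c^2 / 4 = (p t)^2 / 16, whence 1728 = 16 * 108. *)
have -> : lam * (36 * k%:R) ^+ 2 = 108 * k%:R * (p * t) by rewrite /lam /D; field.
rewrite /c; move: ptk pt0; set x := p * t => ptk pt0.
have := ler_wpM2r (ltW pt0) ptk; lra.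
Qed.
End FailureProbability.

(** * Choice of the order of the moment *)

(** From e^(-1/2) >= 1 - 1/2 one gets e^(1/2) <= 2. *)
Lemma ln2_ge_half (R : realType) : 1 / 2 <= ln (2 : R).
Proof.
rewrite -[leLHS]expRK ler_ln ?posrE ?expR_gt0 ?ltr0n //.
have := @expR_ge1Dx R (- (1 / 2)); rewrite expRN.
have := @expR_gt0 R (1 / 2); set x := expR _ => x0 h.
have : x * (1 / 2) <= x * x^-1 by rewrite ler_wpM2l ?(ltW x0) //; lra.
rewrite divff ?gt_eqF //; lra.
Qed.

(** Round up twice: l to log2 (2n), then 2^m to l, so 2^m <= 2l. Since 2^(l-2) <= n and ln 2 >= 1/2,
    2l <= 4 ln n + 4, and n >= 4 gives ln n >= 1. *)
Lemma moment_order_exists (R : realType) (n : nat) : (4 <= n)%N ->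
  exists m, (n.*2 <= 2 ^ (2 ^ m))%N /\ (2 ^ m)%:R <= 8 * ln (n%:R : R).
Proof.
move=> n4; have n2 : (1 < n.*2)%N by lia.
have /andP[l1 l2] := up_log_bounds (isT : (1 < 2)%N) n2.
set l := up_log 2 n.*2 in l1 l2.
have l_gt1 : (1 < l)%N by rewrite ltnNge; apply/negP; case: (l) l2 => [|[|]]; rewrite ?expn0 ?expn1; lia.
have /andP[m1 m2] := up_log_bounds (isT : (1 < 2)%N) l_gt1.
set m := up_log 2 l in m1 m2; exists m; split.
  by rewrite (leq_trans l2) // leq_pexp2l.
have km : (2 ^ m <= l.*2)%N by move: m1; case: (m) => [|m'] /=; rewrite ?expn0 ?expnS; lia.
have ln2 := ln2_ge_half R.
have lnn : 2 * ln 2 <= ln (n%:R : R).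
  rewrite mulr_natl -lnXn // ler_ln ?posrE ?exprn_gt0 ?ltr0n //; last by lia.
  by rewrite -natrX ler_nat.
have ll : (l%:R - 2) * ln 2 <= ln (n%:R : R).
  rewrite -(natrB _ l_gt1) mulr_natl -lnXn // ler_ln ?posrE ?exprn_gt0 ?ltr0n //; last by lia.
  rewrite -natrX ler_nat; move: l1 l_gt1; case: (l) => [|[|l']] //=.
  by rewrite !subSS subn0 expnS; lia.
have : (2 ^ m)%:R <= 2 * l%:R :> R by rewrite -natrM ler_nat mul2n.
have : 0 <= l%:R - 2 :> R by rewrite subr_ge0 ler_nat.
set x := l%:R - 2 in ll * => x0.
have := ler_wpM2l x0 ln2; rewrite /x in x0 ll *; lra.
Qed.

Lemma mean_deg_ge n : (0 < n)%N -> (6 * n ^ 2 <= mean_deg n)%N.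
Proof. by case: n => // n _; rewrite /mean_deg; nia. Qed.

Theorem theorem4p4 (R : realType) :
  exists C : R, 0 < C /\
  forall p : nat -> R,
    (forall n, 0 <= p n <= 1) ->
    (exists N0 : nat, forall n, (N0 <= n)%N -> C * ln (n%:R) / (n%:R ^+ 2) <= p n) ->
    forall eps : R, 0 < eps ->
      exists N : nat, forall n, (N <= n)%N ->
        1 - eps < gamma_prob (p n)
                    (fun Rel : {set word n} => 1 / 2 < lambda2 (norm_laplacian R Rel)).
Proof.
(* 2304 = 1728 * 8 / 6, with 2^m <= 8 ln n and t >= 6 n^2. *)
exists 2304; split=> // p p01 [N0 hp] eps eps0.
exists (maxn (maxn N0 4) (Num.truncn eps^-1).+1) => n.
rewrite !geq_max => /andP[/andP[N0n n4] neps].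
have n0 : 0 < n%:R :> R by rewrite ltr0n; lia.
have [m [nm mln]] := moment_order_exists R n4.
have /andP[p0 p1] := p01 n.
have ptm : 1728 * (2 ^ m)%:R <= p n * (mean_deg n)%:R.
  have := hp n N0n; rewrite ler_pdivrMr ?exprn_gt0 // => h.
  have : p n * (6 * n%:R ^+ 2) <= p n * (mean_deg n)%:R.
    by rewrite ler_wpM2l // -natrX -natrM ler_nat mean_deg_ge //; lia.
  lra.
apply: lt_le_trans (gamma_prob_lambda2_ge (p01 n) (_ : (1 < n)%N) ptm); last by lia.
(* With k = 2^m and 2n <= 2^k, the error 2n / 4^k is at most 2^-k <= 1 / (2n) < eps. *)
rewrite ltrD2l ltrN2.
have nm' : n.*2%:R <= 2 ^+ (2 ^ m) :> R by rewrite -natrX ler_nat.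
have e : 4 ^+ (2 ^ m) = 2 ^+ (2 ^ m) * 2 ^+ (2 ^ m) :> R.
  by rewrite -exprMn; congr (_ ^+ _); lra.
have x0 : 0 < 2 ^+ (2 ^ m) :> R by rewrite exprn_gt0.
rewrite e ltr_pdivrMr ?mulr_gt0 // mulrA.
have epsn : 1 < eps * n%:R.
  rewrite -ltr_pdivrMl // mulr1 (lt_le_trans (truncnS_gt _)) //.
  by rewrite ler_nat.
rewrite (le_lt_trans nm') // ltr_pMl // (lt_le_trans epsn) //.
rewrite ler_pM2l // (le_trans _ nm') // ler_nat; lia.
Qed.
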